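(* For every integer $n\ge 0$, \begin{align*} F_{(4,0,0),n}(q)&=\sum_{n_1=0}^n\sum_{n_2=0}^{2n_1} \frac{q^{n_1^2+n_2^2-n_1n_2+n_1+n_2}}{(q;q)_{n-n_1}(q;q)_{n_1}}\begin{bmatrix}2n_1\\ n_2\end{bmatrix}_q,\\ F_{(3,1,0),n}(q)&=\sum_{n_1=0}^n\sum_{n_2=0}^{2n_1} \frac{q^{n_1^2+n_2^2-n_1n_2+n_2}}{(q;q)_{n-n_1}(q;q)_{n_1}}\begin{bmatrix}2n_1\\ n_2\end{bmatrix}_q,\\ F_{(3,0,1),n}(q)&=\sum_{n_1=0}^n\sum_{n_2=0}^{2n_1} \frac{q^{n_1^2+n_2^2-n_1n_2}}{(q;q)_{n-n_1}}\frac{q^{n_1}}{(q;q)_{n_1}}\begin{bmatrix}2n_1\\ n_2\end{bmatrix}_q +\sum_{n_1=1}^n\sum_{n_2=0}^{2n_1-2} \frac{q^{n_1^2+n_2^2-n_1n_2}}{(q;q)_{n-n_1}}\frac{q^{2n_2}}{(q;q)_{n_1-1}}\begin{bmatrix}2n_1-2\\ n_2\end{bmatrix}_q,\\ F_{(2,2,0),n}(q)&=\sum_{n_1=0}^n\sum_{n_2=0}^{2n_1} \frac{q^{n_1^2+n_2^2-n_1n_2}}{(q;q)_{n-n_1}}\frac{q^{n_1}}{(q;q)_{n_1}}\begin{bmatrix}2n_1\\ n_2\end{bmatrix}_q +\sum_{n_1=1}^n\sum_{n_2=0}^{2n_1-2} \frac{q^{n_1^2+n_2^2-n_1n_2}}{(q;q)_{n-n_1}}\frac{q^{n_2}(1+q^{n_1+n_2})}{(q;q)_{n_1-1}}\begin{bmatrix}2n_1-2\\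 n_2\end{bmatrix}_q,\\ F_{(2,1,1),n}(q)&=\sum_{n_1=0}^n\sum_{n_2=0}^{2n_1} \frac{q^{n_1^2+n_2^2-n_1n_2}}{(q;q)_{n-n_1}(q;q)_{n_1}}\begin{bmatrix}2n_1\\ n_2\end{bmatrix}_q. \end{align*}
   Context: Partitions are weakly decreasing sequences $\lambda=(\lambda_1,\lambda_2,\ldots)$ of nonnegative integers with finitely many nonzero terms (so $\lambda_j=0$ for $j$ large). Given a composition $c=(c_1,\ldots,c_k)$ of a positive integer into $k$ nonnegative parts, a cylindric partition of profile $c$ is a sequence $\Lambda=(\lambda^{(1)},\ldots,\lambda^{(k)})$ of $k$ partitions such that $\lambda^{(i)}_j\ge\lambda^{(i+1)}_{j+c_{i+1}}$ for all $1\le i\le k-1$ and all $j\ge1$, and $\lambda^{(k)}_j\ge\lambda^{(1)}_{j+c_1}$ for all $j\ge1$. Set $|\Lambda|=\sum_{i=1}^k\sum_{j\ge1}\lambda^{(i)}_j$ and $\max(\Lambda)=\max(\lambda^{(1)}_1,\ldots,\lambda^{(k)}_1)$. For an integer $n\ge0$, $F_{c,n}(q)=\sum q^{|\Lambda|}$, the sum over all cylindric partitions $\Lambda$ of profile $c$ with $\max(\Lambda)\le n$. Notation: $(a;q)_n=\prod_{i=0}^{n-1}(1-aq^i)$, and $\begin{bmatrix}n\\ k\end{bmatrix}_q=\frac{(q;q)_n}{(q;q)_k(q;q)_{n-k}}$ for $0\le k\le n$. *)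

(* Defs.v *)
From HB Require Import structures.
From mathcomp Require Import all_boot all_order all_algebra.
From mathcomp Require Import finmap.
From mathcomp Require Import boolp classical_sets cardinality fsbigop.

Set Implicit Arguments.
Unset Strict Implicit.
Unset Printing Implicit Defensive.

Import GRing.Theory.
Local Open Scope ring_scope.

Record fps (R : Type) := Fps { fps_coef :> nat -> R }.

HB.instance Definition _ (R : Type) := gen_eqMixin (fps R).
HB.instance Definition _ (R : Type) := gen_choiceMixin (fps R).

Lemma fpsP (R : Type) (f g : fps R) : (forall m, f m = g m) <-> f = g.
Proof.
split=> [|-> //]; case: f g => f [g] /= fg; congr Fps; exact/funext.
Qed.

Section FpsRing.
Variable R : comNzRingType.
Implicit Types f g h : fps R.

Definition fps_zero := Fps (fun=> 0 : R).
Definition fps_opp f := Fps (fun m => - f m).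
Definition fps_add f g := Fps (fun m => f m + g m).
Definition fps_one := Fps (fun m => (m == 0%N)%:R : R).
Definition fps_mul f g := Fps (fun m => \sum_(i < m.+1) f i * g (m - i)%N).

Lemma fps_addA : associative fps_add.
Proof. by move=> f g h; apply/fpsP => m /=; rewrite addrA. Qed.
Lemma fps_addC : commutative fps_add.
Proof. by move=> f g; apply/fpsP => m /=; rewrite addrC. Qed.
Lemma fps_add0 : left_id fps_zero fps_add.
Proof. by move=> f; apply/fpsP => m /=; rewrite add0r. Qed.
Lemma fps_addN : left_inverse fps_zero fps_opp fps_add.
Proof. by move=> f; apply/fpsP => m /=; rewrite addNr. Qed.

HB.instance Definition _ :=
  GRing.isZmodule.Build (fps R) fps_addA fps_addC fps_add0 fps_addN.

Definition fps_trunc N f : {poly R} := \poly_(i < N) f i.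

Lemma fps_mul_trunc N f g m : (m < N)%N ->
  fps_mul f g m = (fps_trunc N f * fps_trunc N g)`_m.
Proof.
move=> mN; rewrite coefM; apply: eq_bigr => i _; rewrite !coef_poly.
by rewrite (leq_ltn_trans (leq_ord i) mN) (leq_ltn_trans (leq_subr _ _) mN).
Qed.

Lemma coef_mul_congr (p p' r r' : {poly R}) m :
  (forall i, (i <= m)%N -> p`_i = p'`_i) ->
  (forall i, (i <= m)%N -> r`_i = r'`_i) -> (p * r)`_m = (p' * r')`_m.
Proof.
move=> pp rr; rewrite !coefM; apply: eq_bigr => i _.
by rewrite pp ?rr ?leq_subr ?leq_ord.
Qed.

Lemma coef_trunc_mul N f g m : (m < N)%N ->
  (fps_trunc N (fps_mul f g))`_m = (fps_trunc N f * fps_trunc N g)`_m.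
Proof. by move=> mN; rewrite coef_poly mN; apply: fps_mul_trunc. Qed.

Lemma fps_mulA : associative fps_mul.
Proof.
move=> f g h; apply/fpsP => m; have mm := ltnSn m.
rewrite !(fps_mul_trunc _ _ mm).
transitivity
  ((fps_trunc m.+1 f * (fps_trunc m.+1 g * fps_trunc m.+1 h))`_m).
  by apply: coef_mul_congr => // i im; apply: coef_trunc_mul.
rewrite mulrA; apply: coef_mul_congr => // i im.
by rewrite coef_trunc_mul.
Qed.

Lemma fps_mulC : commutative fps_mul.
Proof.
move=> f g; apply/fpsP => m.
by rewrite !(fps_mul_trunc _ _ (ltnSn m)) mulrC.
Qed.

Lemma fps_mul1 : left_id fps_one fps_mul.
Proof.
move=> f; apply/fpsP => m /=; rewrite big_ord_recl /= mul1r subn0.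
by rewrite big1 ?addr0 // => i _; rewrite mul0r.
Qed.

Lemma fps_mulDl : left_distributive fps_mul fps_add.
Proof.
move=> f g h; apply/fpsP => m /=; rewrite -big_split /=.
by apply: eq_bigr => i _; rewrite mulrDl.
Qed.

Lemma fps_one_neq0 : fps_one != 0.
Proof.
by apply/eqP => /fpsP /(_ 0%N) /= /eqP; rewrite oner_eq0.
Qed.

HB.instance Definition _ := GRing.Zmodule_isComNzRing.Build (fps R)
  fps_mulA fps_mulC fps_mul1 fps_mulDl fps_one_neq0.

Definition fpsX : fps R := Fps (fun m => (m == 1%N)%:R).

Lemma coef_fps0 m : (0 : fps R) m = 0. Proof. by []. Qed.
Lemma coef_fps1 m : (1 : fps R) m = (m == 0%N)%:R. Proof. by []. Qed.
Lemma coef_fpsX m : fpsX m = (m == 1%N)%:R. Proof. by []. Qed.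
Lemma coef_fpsN f m : (- f) m = - f m. Proof. by []. Qed.
Lemma coef_fpsD f g m : (f + g) m = f m + g m. Proof. by []. Qed.
Lemma coef_fpsM f g m : (f * g) m = \sum_(i < m.+1) f i * g (m - i)%N.
Proof. by []. Qed.

End FpsRing.

Section FpsUnitRing.
Variable R : comUnitRingType.
Implicit Types f g : fps R.

(* The first N coefficients of the solution g of f * g = 1. *)
Fixpoint fps_inv_coefs f (N : nat) : seq R :=
  if N is m.+1 then
    let s := fps_inv_coefs f m in
    rcons s ((f 0%N)^-1 * ((m == 0%N)%:R - \sum_(i < m) s`_i * f (m - i)%N))
  else [::].

Definition fps_unit : pred (fps R) := fun f => f 0%N \is a GRing.unit.
Definition fps_inv f : fps R :=
  if fps_unit f then Fps (fun m => (fps_inv_coefs f m.+1)`_m) else f.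

Lemma size_fps_inv_coefs f N : size (fps_inv_coefs f N) = N.
Proof. by elim: N => //= N IH; rewrite size_rcons IH. Qed.

Lemma nth_fps_inv_coefs f N m : (m < N)%N ->
  (fps_inv_coefs f N)`_m = (fps_inv_coefs f m.+1)`_m.
Proof.
elim: N => // N IH; rewrite ltnS leq_eqVlt => /predU1P[-> //|mN].
by rewrite {1}/fps_inv_coefs -/fps_inv_coefs nth_rcons size_fps_inv_coefs mN IH.
Qed.

Lemma fps_mulVr : {in fps_unit, left_inverse 1 fps_inv *%R}.
Proof.
move=> f uf; have {}uf : fps_unit f by [].
rewrite /fps_inv uf; apply/fpsP => m.
rewrite coef_fpsM coef_fps1 big_ord_recr /= subnn.
rewrite nth_rcons size_fps_inv_coefs ltnn eqxx.
rewrite mulrAC mulVr // mul1r.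
rewrite (_ : \sum_(i < m) _ =
  \sum_(i < m) (fps_inv_coefs f m)`_i * f (m - i)%N); first by rewrite subrKC.
by apply: eq_bigr => i _; rewrite -(nth_fps_inv_coefs f (ltn_ord i)).
Qed.

Lemma fps_unitP f g : g * f = 1 -> fps_unit f.
Proof.
move=> /fpsP /(_ 0%N); rewrite coef_fpsM big_ord1 coef_fps1 /= => gf.
by apply/unitrPr; exists (g 0%N); rewrite mulrC.
Qed.

Lemma fps_invr_out : {in [predC fps_unit], fps_inv =1 id}.
Proof. by move=> f nuf; rewrite /fps_inv (negPf (nuf : ~~ fps_unit f)). Qed.

HB.instance Definition _ := GRing.ComNzRing_hasMulInverse.Build (fps R)
  fps_mulVr fps_unitP fps_invr_out.

Lemma fps_unitE f : (f \is a GRing.unit) = (f 0%N \is a GRing.unit).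
Proof. by []. Qed.

End FpsUnitRing.

Definition qpoch (R : comUnitRingType) (a q : R) (n : nat) : R :=
  \prod_(i < n) (1 - a * q ^+ i).

Definition qbinom (R : comUnitRingType) (q : R) (n k : nat) : R :=
  qpoch q q n / (qpoch q q k * qpoch q q (n - k)).

(* Indices start at 0: [lam j] is the part of index j + 1,
   [L i] is the partition of index i + 1, and [tnth c i] is the entry of index
   i + 1 of the profile. *)

Local Open Scope classical_set_scope.

Definition is_partition (lam : nat -> nat) : Prop :=
  (forall i j, i <= j -> lam j <= lam i)%N /\
  finite_set [set j | lam j <> 0%N].

(* [ordS] is the cyclic successor, so this covers both the k - 1 inequalities
   between consecutive partitions and the one that closes the cylinder. *)
Definition is_cylindric (k : nat) (c : k.-tuple nat) (L : 'I_k -> nat -> nat)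
    : Prop :=
  (forall i, is_partition (L i)) /\
  (forall i j, L (ordS i) (j + tnth c (ordS i)) <= L i j)%N.

Definition cyl_size (k : nat) (L : 'I_k -> nat -> nat) : nat :=
  (\sum_(i < k) \big[addn/0]_(j \in [set: nat]) L i j)%N.

Definition cyl_max (k : nat) (L : 'I_k -> nat -> nat) : nat :=
  (\max_(i < k) L i 0)%N.

Definition cyl_set (k : nat) (c : k.-tuple nat) (n m : nat)
    : set ('I_k -> nat -> nat) :=
  [set L | [/\ is_cylindric c L, (cyl_max L <= n)%N & cyl_size L = m]].

(* [fset_set] is meaningful only on finite sets: see [finite_cyl_set]. *)
Definition cylF (k : nat) (c : k.-tuple nat) (n : nat) : fps int :=
  Fps (fun m => (#|` fset_set (cyl_set c n m)|)%:R).

Lemma leq_size_partition (lam : nat -> nat) (N : nat) : is_partition lam ->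
  (\sum_(j < N) lam j <= \big[addn/0]_(j \in [set: nat]) lam j)%N.
Proof.
move=> [_ fin].
have fin' : finite_set ([set j | lam j <> 0%N] `|` `I_N).
  by rewrite finite_setU; split=> //; apply: finite_II.
rewrite fsbig_ord -(fsbig_widen ([set j | lam j <> 0%N] `|` `I_N) setT) //;
  last by move=> j [_ /= /not_orP[/contrapT]].
rewrite (fsbigID `I_N ([set j | lam j <> 0%N] `|` `I_N)) //=.
rewrite (_ : _ `&` `I_N = `I_N); first exact: leq_addr.
by apply/seteqP; split=> j /=; [case|split=> //; right].
Qed.

Lemma finite_cyl_set (k : nat) (c : k.-tuple nat) (n m : nat) :
  finite_set (cyl_set c n m).
Proof.
pose ext (u : {ffun 'I_k * 'I_m -> 'I_n.+1}) : 'I_k -> nat -> nat :=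
  fun i j => if insub j is Some j' then nat_of_ord (u (i, j')) else 0%N.
apply: (@sub_finite_set _ _ (range ext)); last first.
  by apply: finite_image; apply: finite_finset.
move=> L [[part _] maxL sizeL].
exists [ffun p : 'I_k * 'I_m => inord (L p.1 p.2)] => //.
apply/funext => i; apply/funext => j; rewrite /ext.
have [dec _] := part i.
case: insubP => [j' _ <-|]; rewrite ?ffunE /= ?inordK //.
  rewrite ltnS (leq_trans (dec _ _ (leq0n _))) //.
  by apply: leq_trans maxL; apply: (leq_bigmax i).
rewrite -leqNgt => mj; apply/esym/eqP; rewrite -leqn0 leqNgt; apply/negP => Lij.
have : (m.+1 <= cyl_size L)%N.
  rewrite /cyl_size (bigD1 i) //=; apply: leq_trans (leq_addr _ _).
  apply: leq_trans (leq_size_partition m.+1 (part i)).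
  rewrite -[leqLHS]card_ord -sum1_card; apply: leq_sum => /= l _.
  by apply: leq_trans Lij (dec _ _ _); apply: leq_trans mj; rewrite -ltnS.
by rewrite sizeL ltnn.
Qed.

(* Main.v *)
(** For a profile [c] let [I] be the set of indices [i] with [c_i > 0]. The
    maximum of a cylindric partition is attained at the first part of some row
    of [I], and removing a first part equal to [n] from all rows of a set [J]
    turns profile [c] into another profile [c(J)]. Inclusion-exclusion gives
      [F_(c,n-1) = \sum_(J in I) (-1)^|J| q^(n|J|) F_(c(J),n)].
    Up to rotation there are five profiles of length 3 and sum 4, and the
    resulting linear system, with [F_(c,0) = 1], has only one solution: it
    expresses the [F_(c,n)] through the [F_(c,n-1)] and multiples of [q^n], so
    it is a contraction for the [q]-adic topology.

    The right-hand sides are [\sum_m P_c(m) / (q)_(n-m)], and this transform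
    turns the system into recurrences for the [P_c]. All of them reduce to two
    first-order relations between [P_211] and [P_310], which follow from a
    three-term recurrence for the moments
    [\sum_k q^(m^2 + k^2 - m k + j k) [2m, k]]. *)
Require Import Defs.
From mathcomp Require Import all_boot all_order all_algebra.
From mathcomp Require Import finmap boolp classical_sets functions cardinality.
From mathcomp Require Import fsbigop.
From mathcomp Require Import ring zify.

Set Implicit Arguments.
Unset Strict Implicit.
Unset Printing Implicit Defensive.

Import GRing.Theory.
Local Open Scope ring_scope.

(** * Formal power series *)

Section FpsShift.
Variable R : comNzRingType.
Implicit Types f g h : fps R.

Lemma coef_fpsXM f m : (fpsX R * f) m = if m is m'.+1 then f m' else 0.
Proof.
rewrite coef_fpsM; case: m => [|m].
  by rewrite big_ord1 coef_fpsX mul0r.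
rewrite 2!big_ord_recl !coef_fpsX mul0r add0r mul1r subSS subn0 big1 ?addr0 //.
by move=> i _; rewrite coef_fpsX mul0r.
Qed.

Lemma coef_fpsXnM f e m :
  (fpsX R ^+ e * f) m = if (e <= m)%N then f (m - e)%N else 0.
Proof.
elim: e m => [|e IHe] m; first by rewrite mul1r subn0.
by rewrite exprS -mulrA coef_fpsXM; case: m => // m; rewrite IHe subSS.
Qed.

Lemma coef_fps_sum (I : Type) (r : seq I) (P : pred I) (F : I -> fps R) m :
  (\sum_(i <- r | P i) F i) m = \sum_(i <- r | P i) F i m.
Proof. exact: (big_morph (fun f : fps R => f m)). Qed.

Lemma coef_fps_signM n f m : ((-1) ^+ n * f) m = (-1) ^+ n * f m.
Proof.
by rewrite -[in LHS]signr_odd -[in RHS]signr_odd !mulr_sign; case: odd.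
Qed.

Definition eqmodXn N f g := forall m, (m < N)%N -> f m = g m.

Lemma eqmodXnD N f f' g g' :
  eqmodXn N f f' -> eqmodXn N g g' -> eqmodXn N (f + g) (f' + g').
Proof. by move=> ff gg m mN; rewrite !coef_fpsD ff ?gg. Qed.

Lemma eqmodXnB N f f' g g' :
  eqmodXn N f f' -> eqmodXn N g g' -> eqmodXn N (f - g) (f' - g').
Proof. by move=> ff gg m mN; rewrite !coef_fpsD !coef_fpsN ff ?gg. Qed.

Lemma eqmodXnM N e f g :
  eqmodXn N f g -> eqmodXn N (fpsX R ^+ e * f) (fpsX R ^+ e * g).
Proof.
move=> fg m mN; rewrite !coef_fpsXnM; case: leqP => // em.
by apply: fg; apply: leq_ltn_trans mN; apply: leq_subr.
Qed.

Lemma eqmodXn_contract N e f g h : eqmodXn N f g ->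
  eqmodXn N.+1 (h + fpsX R ^+ e.+1 * f) (h + fpsX R ^+ e.+1 * g).
Proof.
move=> fg m mN; rewrite !coef_fpsD !coef_fpsXnM; case: leqP => // em.
by rewrite fg //; lia.
Qed.

Lemma eqmodXn_eq f g : (forall N, eqmodXn N f g) -> f = g.
Proof. by move=> fg; apply/fpsP => m; apply: (fg m.+1). Qed.

End FpsShift.

Lemma qpoch_fpsX_unit (R : comUnitRingType) n :
  qpoch (fpsX R) (fpsX R) n \is a GRing.unit.
Proof.
rewrite /qpoch; elim/big_ind: _ => [|f g uf ug|i _]; first exact: unitr1.
  by rewrite unitrM uf.
by rewrite fps_unitE coef_fpsD coef_fpsN coef_fps1 coef_fpsXM subr0 unitr1.
Qed.

(** * Cylindric partitions *)

Section InclusionExclusion.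
Local Open Scope classical_set_scope.
Variables (R : comPzRingType) (I : finType).

Lemma sum_sign_subset (D : {set I}) :
  \sum_(J : {set I} | J \subset D) (-1) ^+ #|J| = (D == finset.set0)%:R :> R.
Proof.
transitivity (\prod_(i : I) (- (i \in D)%:R + 1) : R).
  rewrite bigA_distr /= big_mkcond; apply: eq_bigr => J _.
  case: ifPn => [JD|/fintype.subsetPn[i iJ iD]]; last first.
    by rewrite (bigD1 i) //= iJ (negPf iD) oppr0 mul0r.
  rewrite -prodr_const big_mkcond; apply: eq_bigr => i _.
  by case: ifP => // iJ; rewrite (fintype.subsetP JD).
have [->|/finset.set0Pn[i iD]] := eqVneq D finset.set0.
  by rewrite big1 // => i _; rewrite inE oppr0 add0r.
by rewrite (bigD1 i) //= iD addNr mul0r.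
Qed.

Lemma card_fset_set_sum_mem (T : choiceType) (A B : set T) :
  finite_set A -> B `<=` A ->
  #|` fset_set B|%:R = \sum_(x <- fset_set A) (x \in B)%:R :> R.
Proof.
move=> finA BA; have finB := sub_finite_set BA finA.
have -> : fset_set B = [fset x in fset_set A | x \in B]%fset.
  apply/fsetP => x; rewrite !inE /= !in_fset_set // andb_idl // !inE.
  exact: BA.
rewrite card_fset_sum1 natr_sum big_fset big_mkcond.
by apply: eq_bigr => x _; case: ifP.
Qed.

Lemma card_sieve (T : choiceType) (A : set T) (P : I -> set T) (D : {set I}) :
  finite_set A ->
  #|` fset_set (A `\` \bigcup_(i in [set` D]) P i)|%:R =
  \sum_(J : {set I} | J \subset D)
    (-1) ^+ #|J| * #|` fset_set (A `&` \bigcap_(i in [set` J]) P i)|%:R :> R.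
Proof.
move=> finA; rewrite (card_fset_set_sum_mem finA); last by move=> x [].
under [RHS]eq_bigr => J _.
  rewrite (card_fset_set_sum_mem finA); last by move=> x [].
  rewrite mulr_sumr; over.
rewrite exchange_big; apply: eq_big_seq => x; rewrite in_fset_set // inE => Ax.
pose E := [set i in D | x \in P i]%SET.
have -> : (x \in A `\` \bigcup_(i in [set` D]) P i) = (E == finset.set0).
  apply/idP/eqP => [/set_mem[_ nPx]|E0].
    apply/setP => i; rewrite !inE; apply/negP => /andP[iD /set_mem Pi].
    by apply: nPx; exists i.
  apply/mem_set; split=> // -[i /= iD Pi].
  by have : i \in E; [rewrite inE iD mem_set|rewrite E0 inE].
rewrite -sum_sign_subset big_mkcond [RHS]big_mkcond; apply: eq_bigr => J _.
have [JE|nJE] := boolP (J \subset E).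
  have JD : J \subset D.
    apply: fintype.subset_trans JE _.
    by apply/fintype.subsetP => i; rewrite inE => /andP[].
  rewrite JD mem_set ?mulr1 //; split=> // i /= /(fintype.subsetP JE).
  by rewrite inE => /andP[_ /set_mem].
case: ifP => // JD; rewrite memNset ?mulr0 // => -[_ Px].
case/negP: nJE; apply/fintype.subsetP => i iJ.
by rewrite inE (fintype.subsetP JD) //= mem_set //; apply: Px.
Qed.

End InclusionExclusion.

Section Cylindric.
Local Open Scope classical_set_scope.

Lemma card_fset_set_bij (T U : choiceType) (A : set T) (B : set U)
    (f : T -> U) :
  finite_set A -> finite_set B -> set_bij A B f ->
  #|` fset_set A| = #|` fset_set B|.
Proof.
by move=> finA finB /Pbij[g _]; apply/fcard_eq => //; apply: pcard_eq g.
Qed.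

Lemma fsbig_nat_recl (R : Type) (idx : R) (op : Monoid.com_law idx)
    (f : nat -> R) : finite_set [set j | f j.+1 <> idx] ->
  \big[op/idx]_(j \in [set: nat]) f j =
  op (f 0%N) (\big[op/idx]_(j \in [set: nat]) f j.+1).
Proof.
set S := [set j | f j.+1 <> idx] => finS.
rewrite -(@fsbig_widen _ _ _ _ ([set 0%N] `|` succn @` S)) //; last first.
  move=> [|j] [_ /= /not_orP[j0 jS]] //.
  by apply: contrapT => fj; apply: jS; exists j.
rewrite fsbigU0 //; [|exact: finite_image|by move=> _ [-> []]].
rewrite fsbig_set1 fsbig_image; last by move=> i j _ _ [].
congr (op _ _); apply: fsbig_widen => // j [_].
exact: contrapT.
Qed.

Lemma is_partitionS (lam : nat -> nat) :
  is_partition lam <->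
  (lam 1 <= lam 0)%N /\ is_partition (fun j => lam j.+1).
Proof.
split=> [[dec fin]|[le10 [dec fin]]].
  split; first exact: dec.
  split=> [i j ij|]; first exact: dec.
  apply: sub_finite_set fin => j /= lj lj0; apply: lj.
  by apply/eqP; rewrite -leqn0 -lj0 dec.
split=> [[|i] [|j] ij //|].
- by apply: leq_trans le10; apply: dec.
- exact: dec.
- pose S := [set j | lam j.+1 <> 0%N].
  apply: (@sub_finite_set _ _ ([set 0%N] `|` succn @` S)).
    by move=> [|j] lj; [left|right; exists j].
  by rewrite finite_setU; split; [exact: finite_set1|exact: finite_image].
Qed.

Lemma cyl_max_geP k n (L : 'I_k -> nat -> nat) :
  (cyl_max L <= n)%N <-> forall i, (L i 0 <= n)%N.
Proof. by split=> [/bigmax_leqP h i|h]; [exact: h|apply/bigmax_leqP]. Qed.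

Lemma ordS_ind k (P : 'I_k -> Prop) (i0 : 'I_k) :
  P i0 -> (forall i, P i -> P (ordS i)) -> forall i, P i.
Proof.
move=> P0 PS i.
have iterP t : P (iter t (@ordS k) i0) by elim: t => //= t; exact: PS.
have itE t : iter t (@ordS k) i0 = ((i0 + t) %% k)%N :> nat.
  elim: t => [|t IHt] /=; first by rewrite addn0 modn_small.
  by rewrite IHt -addn1 modnDml addn1 addnS.
suff -> : i = iter (k - i0 + i) (@ordS k) i0 by exact: iterP.
apply: val_inj; rewrite /= itE addnA subnKC; last exact: ltnW.
by rewrite modnDl modn_small.
Qed.

Definition profile_support k (c : k.-tuple nat) : {set 'I_k} :=
  [set i | (0 < tnth c i)%N]%SET.

(* Removing the first part of the rows in [J] turns profile [c] into this one,
   provided [J] is included in the support of [c]. *)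
Definition cut_profile k (c : k.-tuple nat) (J : {set 'I_k}) : k.-tuple nat :=
  [tuple (tnth c i - (i \in J) + (ord_pred i \in J))%N | i < k].

Definition cut_rows k (J : {set 'I_k}) (L : 'I_k -> nat -> nat) i j :=
  L i (j + (i \in J))%N.

Definition fill_rows k (J : {set 'I_k}) n (L : 'I_k -> nat -> nat) i j :=
  if i \in J then (if j is j'.+1 then L i j' else n) else L i j.

Definition cyl_full_set k (c : k.-tuple nat) n (J : {set 'I_k}) m :
    set ('I_k -> nat -> nat) :=
  cyl_set c n m `&` \bigcap_(i in [set` J]) [set L | L i 0%N = n].

Section CutProfile.
Variables (k : nat) (c : k.-tuple nat) (n : nat) (J : {set 'I_k}).
Implicit Types L : 'I_k -> nat -> nat.

Lemma cut_rowsK L :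
  (forall i, i \in J -> L i 0%N = n) -> fill_rows J n (cut_rows J L) = L.
Proof.
move=> LJ; apply/funext => i; apply/funext => j; rewrite /fill_rows /cut_rows.
case: (boolP (i \in J)) => [/LJ <-|_]; rewrite ?addn0 //.
by case: j => [|j]; rewrite ?addn1.
Qed.

Lemma fill_rowsK L : cut_rows J (fill_rows J n L) = L.
Proof.
apply/funext => i; apply/funext => j; rewrite /fill_rows /cut_rows.
by case: (i \in J); rewrite ?addn1 ?addn0.
Qed.

Lemma cyl_size_cut_rows L :
  (forall i, is_partition (L i)) -> (forall i, i \in J -> L i 0%N = n) ->
  cyl_size L = (n * #|J| + cyl_size (cut_rows J L))%N.
Proof.
move=> part LJ; rewrite /cyl_size.
rewrite mulnC -sum_nat_const [in RHS]big_mkcond -big_split.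
apply: eq_bigr => i _ /=; rewrite /cut_rows; case: ifP => [iJ|_]; last first.
  by under [in RHS]eq_fsbigr do rewrite addn0.
have [_ [_ fin]] := (is_partitionS (L i)).1 (part i).
rewrite fsbig_nat_recl // LJ //.
by under [in RHS]eq_fsbigr do rewrite addn1.
Qed.

Hypothesis J_support : J \subset profile_support c.

Lemma cut_profileE i :
  (tnth c (ordS i) + (i \in J) =
   tnth (cut_profile c J) (ordS i) + (ordS i \in J))%N.
Proof.
rewrite tnth_mktuple ordSK addnAC subnK //.
by case: (boolP (_ \in J)) => // /(fintype.subsetP J_support); rewrite inE.
Qed.

Lemma cyl_set_cut_rows m L : cyl_full_set c n J m L ->
  exists2 m', m = (n * #|J| + m')%N &
    cyl_set (cut_profile c J) n m' (cut_rows J L).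
Proof.
case=> -[[part cyl] /cyl_max_geP maxL sizeL] LJ.
exists (cyl_size (cut_rows J L)).
  by rewrite -sizeL; apply: cyl_size_cut_rows.
split=> //.
  split=> [i|i j]; rewrite /cut_rows.
    case: (i \in J); last by under eq_fun do rewrite addn0.
    under eq_fun do rewrite addn1.
    by have [] := (is_partitionS (L i)).1 (part i).
  by rewrite -addnA -cut_profileE [(tnth _ _ + _)%N]addnC addnA; apply: cyl.
apply/cyl_max_geP => i; apply: leq_trans (maxL i).
by have [dec _] := part i; apply: dec.
Qed.

Lemma cyl_full_set_fill_rows m L : cyl_set (cut_profile c J) n m L ->
  cyl_full_set c n J (n * #|J| + m) (fill_rows J n L).
Proof.
case=> -[part cyl] /cyl_max_geP maxL sizeL.
have fill0 i : (fill_rows J n L i 0 <= n)%N.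
  by rewrite /fill_rows; case: (i \in J).
have fillJ i : i \in J -> fill_rows J n L i 0%N = n by rewrite /fill_rows => ->.
have partF i : is_partition (fill_rows J n L i).
  by rewrite /fill_rows; case: (i \in J) => //; apply/is_partitionS; split.
split=> //; split; last by rewrite cyl_size_cut_rows // fill_rowsK sizeL.
  split=> // i j; have [dec _] := partF i.
  have shift l j' : L l j' = fill_rows J n L l (j' + (l \in J))%N.
    by rewrite -[in LHS](fill_rowsK L).
  have [jJ|] := leqP (i \in J) j.
    rewrite -(subnK jJ) -addnA [((i \in J) + _)%N]addnC cut_profileE addnA.
    by rewrite -!shift; apply: cyl.
  case: (boolP (i \in J)) => // iJ; case: j => // _; rewrite fillJ //.
  have [decS _] := partF (ordS i); exact: leq_trans (decS _ _ (leq0n _)) _.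
exact/cyl_max_geP.
Qed.

Lemma card_cyl_full_set m :
  #|` fset_set (cyl_full_set c n J m)|%:R =
  (fpsX int ^+ (n * #|J|) * cylF (cut_profile c J) n) m.
Proof.
rewrite coef_fpsXnM; case: leqP => em; last first.
  rewrite (_ : cyl_full_set _ _ _ _ = set0) ?fset_set0 ?cardfs0 //.
  apply/seteqP; split=> // L /cyl_set_cut_rows[m' mE _].
  by move: em; rewrite mE ltnNge leq_addr.
congr (_%:R); apply: (@card_fset_set_bij _ _ _ _ (cut_rows J)).
- exact/finite_setIl/finite_cyl_set.
- exact: finite_cyl_set.
- split=> [L|L L'|L cL].
  + by case/cyl_set_cut_rows => m' ->; rewrite addKn.
  + move=> /set_mem[_ LJ] /set_mem[_ L'J] eq_cut.
    by rewrite -(cut_rowsK LJ) eq_cut cut_rowsK.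
  + exists (fill_rows J n L); last exact: fill_rowsK.
    by rewrite -(subnKC em); apply: cyl_full_set_fill_rows.
Qed.

End CutProfile.

Lemma cylF0 k (c : k.-tuple nat) : cylF c 0 = 1.
Proof.
have szero : cyl_size (fun (_ : 'I_k) (_ : nat) => 0%N) = 0%N.
  by rewrite /cyl_size big1 // => i _; rewrite fsbig1.
have cyl0E m : cyl_set c 0 m = [set L | L = (fun _ _ => 0%N) /\ m = 0%N].
  apply/seteqP; split=> [L [[part _] /cyl_max_geP maxL <-]|L [-> ->]].
    suff -> : L = fun _ _ => 0%N by [].
    apply/funext => i; apply/funext => j; have [dec _] := part i.
    by apply/eqP; rewrite -leqn0 (leq_trans (dec _ _ (leq0n j))).
  split=> //; last exact/cyl_max_geP.
  split=> // i; split=> //=; rewrite (_ : [set _ | _] = set0) //.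
  by apply/seteqP; split.
apply/fpsP => m; rewrite coef_fps1 /= cyl0E; have [->|/eqP m0] := eqVneq m 0%N.
  rewrite (_ : [set _ | _] = [set fun _ _ => 0%N]) ?fset_set1 ?cardfs1 //.
  by apply/seteqP; split=> L // [].
rewrite (_ : [set _ | _] = set0) ?fset_set0 ?cardfs0 //.
by apply/seteqP; split=> L // [].
Qed.

(* Where the profile vanishes the first part is bounded by the previous one,
   so the maximum is attained in a row of the support. *)
Lemma cyl_set_leS k (c : k.-tuple nat) n m : (0 < \sum_(i < k) tnth c i)%N ->
  cyl_set c n m = cyl_set c n.+1 m
    `\` \bigcup_(i in [set` profile_support c]) [set L | L i 0%N = n.+1].
Proof.
rewrite lt0n sum_nat_eq0 => /forallPn[/= i0]; rewrite -lt0n => ci0.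
apply/seteqP; split=> L.
  case=> cylL /cyl_max_geP maxL sizeL; split.
    by split=> //; apply/cyl_max_geP => i; rewrite leqW.
  by move=> [i _ /= Li]; have := maxL i; rewrite Li ltnn.
case=> -[cylL /cyl_max_geP maxL sizeL] nL; split=> //.
have L_le i : i \in profile_support c -> (L i 0 <= n)%N.
  move=> ci; rewrite -ltnS ltn_neqAle maxL andbT.
  by apply/eqP => Li; apply: nL; exists i.
apply/cyl_max_geP; apply: (@ordS_ind _ _ i0) => [|i Lin].
  by apply: L_le; rewrite inE.
have [|] := boolP (ordS i \in profile_support c); first exact: L_le.
rewrite inE -eqn0Ngt => /eqP c0; apply: leq_trans Lin.
by have [_ /(_ i 0%N)] := cylL; rewrite c0 addn0.
Qed.

Theorem cylF_rec k (c : k.-tuple nat) n : (0 < \sum_(i < k) tnth c i)%N ->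
  cylF c n = \sum_(J : {set 'I_k} | J \subset profile_support c)
    (-1) ^+ #|J| * (fpsX int ^+ (n.+1 * #|J|) * cylF (cut_profile c J) n.+1).
Proof.
move=> c_gt0; apply/fpsP => m.
rewrite [LHS]/= (cyl_set_leS n m c_gt0) card_sieve; last exact: finite_cyl_set.
rewrite coef_fps_sum; apply: eq_bigr => J JD.
by rewrite coef_fps_signM -card_cyl_full_set.
Qed.

Lemma cyl_set_rot k (c c' : k.-tuple nat) n m L :
  (forall i, tnth c' i = tnth c (ordS i)) ->
  cyl_set c' n m (fun i => L (ordS i)) <-> cyl_set c n m L.
Proof.
move=> cc'; rewrite /cyl_set /=.
have -> : cyl_size (fun i => L (ordS i)) = cyl_size L.
  by rewrite /cyl_size [RHS](reindex_inj (@ordS_inj k)).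
have -> : cyl_max (fun i => L (ordS i)) = cyl_max L.
  by rewrite /cyl_max [RHS](reindex_inj (@ordS_inj k)).
split=> -[[part cyl] maxL sizeL]; split=> //; split=> [i|i j] //.
- by rewrite -[i]ord_predK.
- by rewrite -[i]ord_predK -cc'; apply: cyl.
- by rewrite cc'.
Qed.

Lemma cylF_rot k (c c' : k.-tuple nat) n :
  (forall i, tnth c' i = tnth c (ordS i)) -> cylF c n = cylF c' n.
Proof.
move=> cc'; apply/fpsP => m /=; congr (_%:R).
apply: (@card_fset_set_bij _ _ _ _ (fun L i => L (ordS i))).
- exact: finite_cyl_set.
- exact: finite_cyl_set.
- split=> [L|L L' _ _ LL'|L].
  + by move/(cyl_set_rot n m L cc').
  + by apply/funext => i; rewrite -[i]ord_predK (congr1 (@^~ _) LL').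
  + pose unrot i := L (ord_pred i).
    have unrotK : (fun i => unrot (ordS i)) = L.
      by apply/funext => i; rewrite /unrot ordSK.
    rewrite -{1}unrotK => /(cyl_set_rot n m unrot cc') cL.
    by exists unrot.
Qed.

End Cylindric.

(** * Profiles of length 3 and sum 4 *)

(* The recurrences of [cylF] for the five rotation classes of profiles of
   length 3 and sum 4, in Horner form with respect to [q ^+ n.+1]. *)
Record cyl_system (R : pzRingType) (q : R) (f400 f310 f301 f220 f211 : nat -> R)
    : Prop := {
  cyl_system_init :
    [/\ f400 0%N = 1, f310 0%N = 1, f301 0%N = 1, f220 0%N = 1 & f211 0%N = 1];
  cyl_system_400 n :
    f400 n.+1 = f400 n + q ^+ n.+1 * f310 n.+1;
  cyl_system_310 n :
    f310 n.+1 = f310 n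
      + q ^+ n.+1 * (f220 n.+1 + f301 n.+1 - q ^+ n.+1 * f211 n.+1);
  cyl_system_301 n :
    f301 n.+1 = f301 n
      + q ^+ n.+1 * (f211 n.+1 + f400 n.+1 - q ^+ n.+1 * f310 n.+1);
  cyl_system_220 n :
    f220 n.+1 = f220 n
      + q ^+ n.+1 * (f301 n.+1 + f211 n.+1 - q ^+ n.+1 * f211 n.+1);
  cyl_system_211 n :
    f211 n.+1 = f211 n
      + q ^+ n.+1 * (f211 n.+1 + f220 n.+1 + f310 n.+1
          - q ^+ n.+1 * (f211 n.+1 + f220 n.+1 + f301 n.+1
              - q ^+ n.+1 * f211 n.+1)) }.

Lemma cylF_rot3 a b c n : cylF [tuple a; b; c] n = cylF [tuple b; c; a] n.
Proof. by apply: cylF_rot; case=> -[|[|[|//]]]. Qed.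

Definition mask3 (x y z : bool) : {set 'I_3} :=
  [set i : 'I_3 | nth false [:: x; y; z] i]%SET.

Lemma big_set_ord3 (R : Type) (idx : R) (op : Monoid.com_law idx)
    (F : {set 'I_3} -> R) :
  \big[op/idx]_(J : {set 'I_3}) F J =
  \big[op/idx]_(x : bool) \big[op/idx]_(y : bool) \big[op/idx]_(z : bool)
     F (mask3 x y z).
Proof.
rewrite pair_bigA pair_bigA /=.
rewrite (reindex (fun b : bool * bool * bool => mask3 b.1.1 b.1.2 b.2)) //=.
pose o j : 'I_3 := inord j.
exists (fun J : {set 'I_3} => (o 0%N \in J, o 1%N \in J, o 2%N \in J)).
  by move=> [[x y] z] _; rewrite !inE !inordK.
move=> J _; apply/setP => i; rewrite inE /=.
by rewrite -[i in RHS]inord_val; case: i => -[|[|[|//]]].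
Qed.

Lemma card_mask3 x y z : #|mask3 x y z| = (x + y + z)%N.
Proof.
rewrite -sum1_card big_mkcond !big_ord_recl big_ord0 !inE /= addn0 addnA.
by case: x y z => [] [] [].
Qed.

Lemma mask3_subset a b c x y z :
  (mask3 x y z \subset profile_support [tuple a; b; c]) =
  [&& x ==> (0 < a)%N, y ==> (0 < b)%N & z ==> (0 < c)%N].
Proof.
transitivity (\big[andb/true]_(i < 3)
    ((i \in mask3 x y z) ==> (i \in profile_support [tuple a; b; c]))).
  rewrite big_andE; apply/fintype.subsetP/forallP => sub i.
    by rewrite implyTb; apply/implyP/sub.
  by have /implyP/(_ isT)/implyP := sub i.
by rewrite !big_ord_recl big_ord0 !inE !(tnth_nth 0%N) andbT.
Qed.

Lemma cut_profile_mask3 a b c x y z :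
  cut_profile [tuple a; b; c] (mask3 x y z) =
  [tuple (a - x + z)%N; (b - y + x)%N; (c - z + y)%N].
Proof.
apply: eq_from_tnth => i; rewrite tnth_mktuple !inE !(tnth_nth 0%N).
by case: i => -[|[|[|//]]].
Qed.

(* Truncation is harmless: an index [a.-1] comes with the factor
   [(0 < a)%:R]. *)
Lemma cylF_rec3 a b c n : (0 < a + b + c)%N ->
  let F a b c := cylF [tuple a; b; c] n.+1 in
  let x := fpsX int ^+ n.+1 in
  F a b c = cylF [tuple a; b; c] n
    + x * ((0 < a)%:R * F a.-1 b.+1 c + (0 < b)%:R * F a b.-1 c.+1
           + (0 < c)%:R * F a.+1 b c.-1
           - x * ((0 < a)%:R * (0 < b)%:R * F a.-1 b c.+1
                  + (0 < b)%:R * (0 < c)%:R * F a.+1 b.-1 c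
                  + (0 < a)%:R * (0 < c)%:R * F a b.+1 c.-1
                  - x * ((0 < a)%:R * (0 < b)%:R * (0 < c)%:R * F a b c))).
Proof.
move=> abc F x; rewrite cylF_rec; last first.
  by rewrite !big_ord_recl big_ord0 addn0 addnA.
rewrite big_mkcond big_set_ord3 !big_bool.
rewrite !card_mask3 !mask3_subset !cut_profile_mask3 !exprM -/x /F => {abc F}.
by case: a b c => [|a] [|b] [|c] /=;
  rewrite ?(addn0, addn1, subn0, subSS); ring.
Qed.

Lemma cylF_system : cyl_system (fpsX int)
  (cylF [tuple 4; 0; 0]%N) (cylF [tuple 3; 1; 0]%N) (cylF [tuple 3; 0; 1]%N)
  (cylF [tuple 2; 2; 0]%N) (cylF [tuple 2; 1; 1]%N).
Proof.
split=> [|n|n|n|n|n]; first by rewrite !cylF0.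
- by rewrite [LHS]cylF_rec3 //=; ring.
- by rewrite [LHS]cylF_rec3 //=; ring.
- by rewrite [LHS]cylF_rec3 //=; ring.
- by rewrite [LHS]cylF_rec3 //= (cylF_rot3 1 3 0) (cylF_rot3 1 2 1); ring.
- rewrite [LHS]cylF_rec3 //= (cylF_rot3 2 0 2) (cylF_rot3 0 2 2).
  by rewrite (cylF_rot3 1 1 2) (cylF_rot3 1 2 1); ring.
Qed.

Lemma cyl_system_unique (R : comNzRingType)
    (f400 f310 f301 f220 f211 g400 g310 g301 g220 g211 : nat -> fps R) :
  cyl_system (fpsX R) f400 f310 f301 f220 f211 ->
  cyl_system (fpsX R) g400 g310 g301 g220 g211 ->
  forall n, [/\ f400 n = g400 n, f310 n = g310 n, f301 n = g301 n,
                f220 n = g220 n & f211 n = g211 n].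
Proof.
move=> [f_init f400S f310S f301S f220S f211S].
move=> [g_init g400S g310S g301S g220S g211S].
elim=> [|n [eq400 eq310 eq301 eq220 eq211]].
  by move: f_init g_init => [-> -> -> -> ->] [-> -> -> -> ->].
have eqmod N : [/\ eqmodXn N (f400 n.+1) (g400 n.+1),
    eqmodXn N (f310 n.+1) (g310 n.+1), eqmodXn N (f301 n.+1) (g301 n.+1),
    eqmodXn N (f220 n.+1) (g220 n.+1) & eqmodXn N (f211 n.+1) (g211 n.+1)].
  elim: N => // N [IH400 IH310 IH301 IH220 IH211].
  split; [rewrite f400S g400S eq400|rewrite f310S g310S eq310
    |rewrite f301S g301S eq301|rewrite f220S g220S eq220
    |rewrite f211S g211S eq211]; apply: eqmodXn_contract;
    by do ?[assumption | apply: eqmodXnB | apply: eqmodXnD | apply: eqmodXnM].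
by split; apply: eqmodXn_eq => N; have [] := eqmod N.
Qed.

(** * Gaussian binomials *)

Section GaussBinomial.
Variables (R : comNzRingType) (q : R).

(* Unlike [qbinom], this vanishes for [n < k]. *)
Fixpoint gbinom n k : R :=
  match n, k with
  | _, 0%N => 1
  | 0%N, _.+1 => 0
  | n'.+1, k'.+1 => gbinom n' k' + q ^+ k * gbinom n' k
  end.

Lemma gbinom0 n : gbinom n 0 = 1.
Proof. by case: n. Qed.

Lemma gbinomS n k :
  gbinom n.+1 k.+1 = gbinom n k + q ^+ k.+1 * gbinom n k.+1.
Proof. by []. Qed.

Lemma gbinom_small n k : (n < k)%N -> gbinom n k = 0.
Proof.
elim: n k => [|n IHn] [|k] //; rewrite ltnS => nk.
by rewrite gbinomS !IHn ?mulr0 ?addr0 // ltnW.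
Qed.

Lemma mul_gbinom_left n k :
  (1 - q ^+ k.+1) * gbinom n k.+1 = (1 - q ^+ (n - k)) * gbinom n k.
Proof.
elim: n k => [|n IHn] k; first by rewrite sub0n subrr mul0r mulr0.
case: k => [|k].
  by rewrite gbinomS mulrDr mulrCA IHn !gbinom0 !subn0 [q ^+ n.+1]exprS; ring.
rewrite gbinomS mulrDr mulrCA IHn subSS gbinomS mulrDr -(IHn k).
have [kn|nk] := ltnP k n; last by rewrite gbinom_small //; ring.
have exp_left : q ^+ k.+2 * q ^+ (n - k.+1) = q ^+ n.+1.
  by rewrite -exprD addSn subnKC.
have exp_right : q ^+ (n - k) * q ^+ k.+1 = q ^+ n.+1.
  by rewrite -exprD addnS subnK // ltnW.
by rewrite mulrA mulrBr exp_left; ring: exp_right.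
Qed.

Lemma mul_gbinom_diag n k :
  (1 - q ^+ n.+1) * gbinom n k = (1 - q ^+ k.+1) * gbinom n.+1 k.+1.
Proof.
have [kn|nk] := leqP k n; last by rewrite !gbinom_small ?mulr0.
have <- : q ^+ k.+1 * q ^+ (n - k) = q ^+ n.+1 by rewrite -exprD addSn subnKC.
by rewrite gbinomS mulrDr mulrCA mul_gbinom_left; ring.
Qed.

Lemma sum_gbinomS n (f : nat -> R) :
  \sum_(0 <= k < n.+2) f k * gbinom n.+1 k =
  \sum_(0 <= k < n.+1) (f k.+1 + q ^+ k * f k) * gbinom n k.
Proof.
have tail : \sum_(0 <= k < n.+2) q ^+ k * f k * gbinom n k =
            \sum_(0 <= k < n.+1) q ^+ k * f k * gbinom n k.
  by rewrite big_nat_recr //= gbinom_small // mulr0 addr0.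
under [RHS]eq_bigr do rewrite mulrDl.
rewrite [RHS]big_split /= -tail big_nat_recl // [X in _ = _ + X]big_nat_recl //.
rewrite !gbinom0 expr0 mul1r addrCA -big_split /=; congr (_ + _).
by apply: eq_bigr => k _; ring.
Qed.

Definition quadf m k : nat := (m ^ 2 + k ^ 2 - m * k)%N.

Lemma quadfSl m k : (quadf m.+1 k + k = quadf m k + 2 * m + 1)%N.
Proof. by rewrite /quadf; nia. Qed.

Lemma quadfSr m k : (quadf m k.+1 + m = quadf m k + 2 * k + 1)%N.
Proof. by rewrite /quadf; nia. Qed.

Definition qmoment m j : R :=
  \sum_(0 <= k < (2 * m).+1) q ^+ (quadf m k + j * k) * gbinom (2 * m) k.

(* Insert the factor [1 - q^k] into [qmoment m j]: either expand it, or absorb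
   it in the binomial and shift [k]. *)
Lemma qmoment_rec m j :
  q ^+ j.+1 * qmoment m j.+2 =
  q ^+ m * (qmoment m j - qmoment m j.+1)
  + q ^+ j.+1 * (q ^+ m) ^+ 2 * qmoment m j.+1.
Proof.
apply: (canRL (subrK _)); apply/esym.
transitivity (\sum_(0 <= k < (2 * m).+2)
    q ^+ (quadf m k + m + j * k) * ((1 - q ^+ k) * gbinom (2 * m) k)).
  rewrite big_nat_recr //= gbinom_small // !mulr0 addr0 /qmoment -sumrB.
  by rewrite mulr_sumr; apply: eq_bigr => k _; rewrite mulSn !exprD; ring.
rewrite big_nat_recl // expr0 subrr mul0r mulr0 add0r /qmoment !mulr_sumr.
rewrite -sumrB; apply: eq_big_nat => k /andP[_]; rewrite ltnS => km.
rewrite mul_gbinom_left quadfSr.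
have <- : q ^+ k * q ^+ (2 * m - k) = (q ^+ m) ^+ 2.
  by rewrite -exprD subnKC // mulnC exprM.
by rewrite !mulSn !mul0n mulnS !addn0 !exprD expr1 exprS; ring.
Qed.

Lemma qmomentS_expand m j : qmoment m.+1 j =
  q ^+ j.+1 * (q ^+ j.+2 * qmoment m j.+3)
  + q ^+ m * (1 + q) * (q ^+ j.+1 * qmoment m j.+2)
  + q * (q ^+ m) ^+ 2 * qmoment m j.+1.
Proof.
rewrite /qmoment (_ : 2 * m.+1 = (2 * m).+2)%N; last by lia.
rewrite !sum_gbinomS !mulr_sumr -!big_split /=; apply: eq_bigr => k _.
have -> : (quadf m.+1 k.+2 + j * k.+2 =
           j.+1 + (j.+2 + (quadf m k + j.+3 * k)))%N by rewrite /quadf; nia.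
have -> : (quadf m.+1 k.+1 + j * k.+1 =
           m + j.+1 + (quadf m k + j.+1 * k))%N by rewrite /quadf; nia.
have shift_exp : q ^+ k * (q ^+ k * q ^+ (quadf m.+1 k + j * k)) =
         q * (q ^+ m) ^+ 2 * q ^+ (quadf m k + j.+1 * k).
  rewrite -exprM -exprS -!exprD; congr (q ^+ _).
  by have := quadfSl m k; nia.
rewrite (mulrDr (q ^+ k)) shift_exp !(mulSn _ k) !exprD [q ^+ k.+1]exprS.
by ring.
Qed.

Lemma qmomentS m j : let y := q ^+ m in let z := q ^+ j.+1 in
  qmoment m.+1 j =
  q * y ^+ 2 * (1 + z * y) * qmoment m j
  + y * (z + q * y - q * y * (1 + z * y) * (1 - z * y)) * qmoment m j.+1.
Proof.
move=> y z; rewrite qmomentS_expand !qmoment_rec -/y -/z [q ^+ j.+2]exprS -/z.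
by have := qmoment_rec m j; rewrite -/y -/z => rec; ring: rec.
Qed.

Lemma qmoment0_S m : let y := q ^+ m in qmoment m.+1 0 =
  q * y ^+ 2 * (1 + q * y) * qmoment m 0
  + q * y * (1 + q ^+ 2 * y ^+ 3) * qmoment m 1.
Proof. by move=> y; rewrite qmomentS -/y; ring. Qed.

Lemma qmoment1_S m : let y := q ^+ m in qmoment m.+1 1 =
  (q * y) ^+ 2 * qmoment m.+1 0
  + q * y ^+ 2 * (1 - (q * y) ^+ 2) * (qmoment m 0 + q * y * qmoment m 1).
Proof.
move=> y; rewrite !qmomentS -/y.
by have := qmoment_rec m 0; rewrite -/y expr1 => rec; ring: rec.
Qed.

End GaussBinomial.

(** * The transform of the right-hand sides *)

Section SequenceDifference.
Variable R : pzRingType.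
Implicit Types f g : nat -> R.

Definition seq_shift f n : R := if n is m.+1 then f m else 0.
Definition seq_diff f n : R := f n - seq_shift f n.

Lemma eq_seq_diff f g : f =1 g -> seq_diff f =1 seq_diff g.
Proof. by move=> fg; case=> [|m]; rewrite /seq_diff /= !fg. Qed.

Lemma seq_diffS f n : f n.+1 = f n + seq_diff f n.+1.
Proof. by rewrite /seq_diff /= addrC subrK. Qed.

End SequenceDifference.

Section QTransform.
Variables (R : comUnitRingType) (q : R).
Hypothesis qpoch_unit : forall n, qpoch q q n \is a GRing.unit.
Implicit Types f g : nat -> R.

Lemma qpoch0 : qpoch q q 0 = 1.
Proof. by rewrite /qpoch big_ord0. Qed.

Lemma qpochS n : qpoch q q n.+1 = qpoch q q n * (1 - q ^+ n.+1).
Proof. by rewrite /qpoch big_ord_recr /= -exprS. Qed.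

Lemma qpoch_invS n : (1 - q ^+ n.+1) / qpoch q q n.+1 = (qpoch q q n)^-1.
Proof.
have := qpoch_unit n.+1; rewrite qpochS unitrM => /andP[u1 u2].
by rewrite invrM // mulrA divrr // mul1r.
Qed.

Lemma gbinom_qpoch n k : (k <= n)%N ->
  gbinom q n k * (qpoch q q k * qpoch q q (n - k)) = qpoch q q n.
Proof.
elim: n k => [|n IHn] [|k] //; try by rewrite gbinom0 qpoch0 !mul1r.
rewrite ltnS subSS => kn; rewrite !qpochS -(IHn k kn).
by rewrite [RHS]mulrAC [gbinom q n k * _]mulrC mul_gbinom_diag; ring.
Qed.

Lemma qbinomE n k : (k <= n)%N -> qbinom q n k = gbinom q n k.
Proof.
by move=> kn; rewrite /qbinom -(gbinom_qpoch kn) mulrK // unitrM !qpoch_unit.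
Qed.

Definition qdiff f : nat -> R := seq_diff (fun n => q ^+ n * f n).

Definition qtrans f n : R :=
  \sum_(0 <= m < n.+1) f m / qpoch q q (n - m).

Lemma eq_qtrans f g : f =1 g -> qtrans f =1 qtrans g.
Proof. by move=> fg n; apply: eq_bigr => m _; rewrite fg. Qed.

Lemma qtransD f g n : qtrans (fun m => f m + g m) n = qtrans f n + qtrans g n.
Proof.
by rewrite /qtrans -big_split /=; apply: eq_bigr => m _; rewrite mulrDl.
Qed.

Lemma qtransB f g n : qtrans (fun m => f m - g m) n = qtrans f n - qtrans g n.
Proof. by rewrite /qtrans -sumrB; apply: eq_bigr => m _; rewrite mulrBl. Qed.

Lemma qtrans0 f : qtrans f 0 = f 0%N.
Proof. by rewrite /qtrans big_nat1 qpoch0 divr1. Qed.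

Lemma qtrans_shift f n : qtrans (seq_shift f) n = seq_shift (qtrans f) n.
Proof.
case: n => [|n]; first by rewrite qtrans0.
by rewrite /qtrans big_nat_recl //= mul0r add0r.
Qed.

Lemma qtrans_diff f n : qtrans (seq_diff f) n = seq_diff (qtrans f) n.
Proof. by rewrite qtransB qtrans_shift. Qed.

(* [q^(n-m) / (q)_(n-m) = 1 / (q)_(n-m) - 1 / (q)_(n-m-1)] *)
Lemma qtrans_qdiff f n : qtrans (qdiff f) n = q ^+ n * qtrans f n.
Proof.
rewrite qtrans_diff; case: n => [|n].
  by rewrite /seq_diff /= subr0 !qtrans0.
rewrite /seq_diff /seq_shift /qtrans mulr_sumr !(big_nat_recr n.+1) //=.
rewrite subnn qpoch0 !divr1 addrAC -sumrB; congr (_ + _).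
apply: eq_big_nat => m /andP[_]; rewrite ltnS => mn.
have -> : q ^+ n.+1 = q ^+ m * q ^+ (n - m).+1 by rewrite -exprD addnS subnKC.
by rewrite subSn // -(qpoch_invS (n - m)); ring.
Qed.

Lemma qtrans_rec f g : (forall m, f m = q ^+ m * g m) ->
  forall n, qtrans f n.+1 = qtrans f n + q ^+ n.+1 * qtrans g n.+1.
Proof.
move=> fg n; rewrite seq_diffS -qtrans_qdiff -qtrans_diff; congr (_ + _).
exact/eq_qtrans/eq_seq_diff.
Qed.

(* [innerabc] is [P_c] for the profile [(a, b, c)]: the sum over [n2], divided
   by [(q)_(n1)]. *)
Definition inner211 m : R := qmoment q m 0 / qpoch q q m.
Definition inner310 m : R := qmoment q m 1 / qpoch q q m.
Definition inner400 m : R := q ^+ m * inner310 m.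
Definition inner301 m : R :=
  q ^+ m * inner211 m
  + seq_shift (fun l => q ^+ (2 * l + 1) * inner310 l) m.
Definition inner220 m : R :=
  q ^+ m * inner211 m
  + seq_shift (fun l => q ^+ (2 * l + 1) * inner211 l) m
  + seq_shift (fun l => q ^+ (2 * l + 1) * (q ^+ l.+1 * inner310 l)) m.

Lemma inner211_0 : inner211 0 = 1.
Proof. by rewrite /inner211 /qmoment big_nat1 mulr1 qpoch0 divr1. Qed.

Lemma inner310_0 : inner310 0 = 1.
Proof. by rewrite /inner310 /qmoment big_nat1 mulr1 qpoch0 divr1. Qed.

Lemma inner211_S m : let y := q ^+ m in
  (1 - q * y) * inner211 m.+1 =
  q * y ^+ 2 * (1 + q * y) * inner211 m
  + q * y * (1 + q ^+ 2 * y ^+ 3) * inner310 m.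
Proof.
move=> y; rewrite /inner211 /inner310 qmoment0_S -/y.
by rewrite -(qpoch_invS m) [q ^+ m.+1]exprS -/y; ring.
Qed.

Lemma inner310_S m : let y := q ^+ m in
  inner310 m.+1 = (q * y) ^+ 2 * inner211 m.+1
    + q * y ^+ 2 * (1 + q * y) * (inner211 m + q * y * inner310 m).
Proof.
move=> y; rewrite /inner211 /inner310 qmoment1_S -/y.
by rewrite -(qpoch_invS m) [q ^+ m.+1]exprS -/y; ring.
Qed.

Lemma inner310_rec m :
  inner310 m = q ^+ m * (inner220 m + inner301 m - qdiff inner211 m).
Proof.
rewrite /qdiff /seq_diff /inner220 /inner301; case: m => [|m] /=.
  by rewrite inner310_0 inner211_0 !expr0; ring.
by rewrite inner310_S (mulnC 2%N m) exprD exprM [q ^+ m.+1]exprS; ring.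
Qed.

Lemma inner301_rec m :
  inner301 m = q ^+ m * (inner211 m + inner400 m - qdiff inner310 m).
Proof.
rewrite /qdiff /seq_diff /inner301 /inner400.
case: m => [|m] /=; first by rewrite !expr0; ring.
by rewrite (mulnC 2%N m) exprD exprM [q ^+ m.+1]exprS; ring.
Qed.

Lemma inner220_rec m :
  inner220 m = q ^+ m * (inner301 m + inner211 m - qdiff inner211 m).
Proof.
rewrite /qdiff /seq_diff /inner220 /inner301.
case: m => [|m] /=; first by rewrite !expr0; ring.
by rewrite (mulnC 2%N m) exprD exprM [q ^+ m.+1]exprS; ring.
Qed.

Lemma inner211_rec m :
  inner211 m = q ^+ m * (inner211 m + inner220 m + inner310 m
    - qdiff (fun l => inner211 l + inner220 l + inner301 l - qdiff inner211 l)
        m).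
Proof.
rewrite /qdiff /seq_diff /inner220 /inner301; case: m => [|[|m]] /=.
- by rewrite inner310_0 inner211_0 !expr0; ring.
- have := inner211_S 0; rewrite /= mulrBl mul1r => /(canRL (subrK _)) rec.
  by rewrite {1}rec inner310_S inner310_0 inner211_0 !expr0; ring.
- have := inner211_S m.+1; rewrite /= mulrBl mul1r => /(canRL (subrK _)) rec.
  rewrite {1}rec !inner310_S !(mulnC 2%N) !(exprD, exprM).
  by rewrite [q ^+ m.+2]exprS [q ^+ m.+1]exprS; ring.
Qed.

Theorem qtrans_inner_system :
  cyl_system q (qtrans inner400) (qtrans inner310) (qtrans inner301)
    (qtrans inner220) (qtrans inner211).
Proof.
split=> [|n|n|n|n|n].
- rewrite !qtrans0 /inner400 /inner301 /inner220 /= inner310_0 inner211_0.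
  by rewrite expr0 mulr1 !addr0.
- exact: (qtrans_rec (fun=> erefl)).
- by rewrite (qtrans_rec inner310_rec) qtransB qtransD qtrans_qdiff.
- by rewrite (qtrans_rec inner301_rec) qtransB qtransD qtrans_qdiff.
- by rewrite (qtrans_rec inner220_rec) qtransB qtransD qtrans_qdiff.
- by rewrite [LHS](qtrans_rec inner211_rec) !(qtransB, qtrans_qdiff, qtransD).
Qed.

Lemma qtrans_qmoment f (a : nat -> R) j n :
  (forall m, f m = a m * (qmoment q m j / qpoch q q m)) ->
  qtrans f n = \sum_(0 <= m < n.+1) \sum_(0 <= k < (2 * m).+1)
    q ^+ quadf m k / qpoch q q (n - m) * (a m * q ^+ (j * k) / qpoch q q m)
      * qbinom q (2 * m) k.
Proof.
move=> fE; apply: eq_bigr => m _; rewrite fE /qmoment mulr_suml mulr_sumr.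
rewrite mulr_suml; apply: eq_big_nat => k; rewrite ltnS => /andP[_ km].
by rewrite qbinomE // exprD; ring.
Qed.

Lemma qtrans_shift_qmoment f (a : nat -> R) j n :
  (forall m, f m = a m * (qmoment q m j / qpoch q q m)) ->
  qtrans (seq_shift (fun m => q ^+ (2 * m + 1) * f m)) n =
  \sum_(1 <= m < n.+1) \sum_(0 <= k < (2 * m - 2).+1)
    q ^+ quadf m k / qpoch q q (n - m)
      * (a m.-1 * q ^+ (j.+1 * k) / qpoch q q (m - 1)) * qbinom q (2 * m - 2) k.
Proof.
move=> fE; rewrite qtrans_shift big_add1 /=; case: n => [|n].
  by rewrite big_geq.
rewrite /seq_shift (@qtrans_qmoment _ (fun m => q ^+ (2 * m + 1) * a m) j).
  apply: eq_bigr => m _; rewrite subSS subn1 mulnS addKn.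
  apply: eq_bigr => k _.
  have quadf_exp :
      q ^+ quadf m.+1 k * q ^+ k = q ^+ (2 * m + 1) * q ^+ quadf m k.
    by rewrite -!exprD quadfSl; congr (q ^+ _); lia.
  by rewrite mulSn [q ^+ (k + _)]exprD; ring: quadf_exp.
by move=> m; rewrite fE mulrA.
Qed.

Lemma qtrans_inner400 n : qtrans inner400 n =
  \sum_(0 <= n1 < n.+1) \sum_(0 <= n2 < (2 * n1).+1)
    q ^+ (n1 ^ 2 + n2 ^ 2 - n1 * n2 + n1 + n2)
      / (qpoch q q (n - n1) * qpoch q q n1) * qbinom q (2 * n1) n2.
Proof.
rewrite (qtrans_qmoment _ (fun=> erefl)); apply: eq_bigr => m _.
by apply: eq_bigr => k _; rewrite invrM // mul1n -/(quadf m k) !exprD; ring.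
Qed.

Lemma qtrans_inner310 n : qtrans inner310 n =
  \sum_(0 <= n1 < n.+1) \sum_(0 <= n2 < (2 * n1).+1)
    q ^+ (n1 ^ 2 + n2 ^ 2 - n1 * n2 + n2)
      / (qpoch q q (n - n1) * qpoch q q n1) * qbinom q (2 * n1) n2.
Proof.
rewrite (qtrans_qmoment _ (fun=> esym (mul1r _))); apply: eq_bigr => m _.
by apply: eq_bigr => k _; rewrite invrM // mul1n -/(quadf m k) exprD; ring.
Qed.

Lemma qtrans_inner211 n : qtrans inner211 n =
  \sum_(0 <= n1 < n.+1) \sum_(0 <= n2 < (2 * n1).+1)
    q ^+ (n1 ^ 2 + n2 ^ 2 - n1 * n2)
      / (qpoch q q (n - n1) * qpoch q q n1) * qbinom q (2 * n1) n2.
Proof.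
rewrite (qtrans_qmoment _ (fun=> esym (mul1r _))); apply: eq_bigr => m _.
by apply: eq_bigr => k _; rewrite invrM // mul0n -/(quadf m k); ring.
Qed.

Lemma qtrans_scaled_inner211 n : qtrans (fun m => q ^+ m * inner211 m) n =
  \sum_(0 <= n1 < n.+1) \sum_(0 <= n2 < (2 * n1).+1)
    q ^+ (n1 ^ 2 + n2 ^ 2 - n1 * n2) / qpoch q q (n - n1)
      * (q ^+ n1 / qpoch q q n1) * qbinom q (2 * n1) n2.
Proof.
rewrite (qtrans_qmoment _ (fun=> erefl)); apply: eq_bigr => m _.
by apply: eq_bigr => k _; rewrite mul0n mulr1.
Qed.

Lemma qtrans_inner301 n : qtrans inner301 n =
  \sum_(0 <= n1 < n.+1) \sum_(0 <= n2 < (2 * n1).+1)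
    q ^+ (n1 ^ 2 + n2 ^ 2 - n1 * n2) / qpoch q q (n - n1)
      * (q ^+ n1 / qpoch q q n1) * qbinom q (2 * n1) n2
  + \sum_(1 <= n1 < n.+1) \sum_(0 <= n2 < (2 * n1 - 2).+1)
    q ^+ (n1 ^ 2 + n2 ^ 2 - n1 * n2) / qpoch q q (n - n1)
      * (q ^+ (2 * n2) / qpoch q q (n1 - 1)) * qbinom q (2 * n1 - 2) n2.
Proof.
rewrite qtransD qtrans_scaled_inner211; congr (_ + _).
rewrite (qtrans_shift_qmoment _ (fun=> esym (mul1r _))).
by apply: eq_bigr => m _; apply: eq_bigr => k _; rewrite mul1r.
Qed.

Lemma qtrans_inner220 n : qtrans inner220 n =
  \sum_(0 <= n1 < n.+1) \sum_(0 <= n2 < (2 * n1).+1)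
    q ^+ (n1 ^ 2 + n2 ^ 2 - n1 * n2) / qpoch q q (n - n1)
      * (q ^+ n1 / qpoch q q n1) * qbinom q (2 * n1) n2
  + \sum_(1 <= n1 < n.+1) \sum_(0 <= n2 < (2 * n1 - 2).+1)
    q ^+ (n1 ^ 2 + n2 ^ 2 - n1 * n2) / qpoch q q (n - n1)
      * (q ^+ n2 * (1 + q ^+ (n1 + n2)) / qpoch q q (n1 - 1))
      * qbinom q (2 * n1 - 2) n2.
Proof.
rewrite !qtransD qtrans_scaled_inner211 -addrA; congr (_ + _).
rewrite (qtrans_shift_qmoment _ (fun=> esym (mul1r _))).
rewrite (qtrans_shift_qmoment _ (fun=> erefl)) -big_split /=.
apply: eq_big_nat => m /andP[m1 _]; rewrite -big_split /=.
apply: eq_bigr => k _; rewrite prednK // -/(quadf m k).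
by rewrite mul1n mulSn mul1n !exprD; ring.
Qed.

End QTransform.

Theorem theorem1p2 (n : nat) :
  let q : fps int := fpsX int in
  [/\ cylF [tuple 4; 0; 0]%N n =
        \sum_(0 <= n1 < n.+1) \sum_(0 <= n2 < (2 * n1).+1)
          q ^+ (n1 ^ 2 + n2 ^ 2 - n1 * n2 + n1 + n2)
            / (qpoch q q (n - n1) * qpoch q q n1) * qbinom q (2 * n1) n2,
      cylF [tuple 3; 1; 0]%N n =
        \sum_(0 <= n1 < n.+1) \sum_(0 <= n2 < (2 * n1).+1)
          q ^+ (n1 ^ 2 + n2 ^ 2 - n1 * n2 + n2)
            / (qpoch q q (n - n1) * qpoch q q n1) * qbinom q (2 * n1) n2,
      cylF [tuple 3; 0; 1]%N n =
        \sum_(0 <= n1 < n.+1) \sum_(0 <= n2 < (2 * n1).+1)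
          q ^+ (n1 ^ 2 + n2 ^ 2 - n1 * n2) / qpoch q q (n - n1)
            * (q ^+ n1 / qpoch q q n1) * qbinom q (2 * n1) n2
        + \sum_(1 <= n1 < n.+1) \sum_(0 <= n2 < (2 * n1 - 2).+1)
          q ^+ (n1 ^ 2 + n2 ^ 2 - n1 * n2) / qpoch q q (n - n1)
            * (q ^+ (2 * n2) / qpoch q q (n1 - 1)) * qbinom q (2 * n1 - 2) n2,
      cylF [tuple 2; 2; 0]%N n =
        \sum_(0 <= n1 < n.+1) \sum_(0 <= n2 < (2 * n1).+1)
          q ^+ (n1 ^ 2 + n2 ^ 2 - n1 * n2) / qpoch q q (n - n1)
            * (q ^+ n1 / qpoch q q n1) * qbinom q (2 * n1) n2
        + \sum_(1 <= n1 < n.+1) \sum_(0 <= n2 < (2 * n1 - 2).+1)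
          q ^+ (n1 ^ 2 + n2 ^ 2 - n1 * n2) / qpoch q q (n - n1)
            * (q ^+ n2 * (1 + q ^+ (n1 + n2)) / qpoch q q (n1 - 1))
            * qbinom q (2 * n1 - 2) n2
    & cylF [tuple 2; 1; 1]%N n =
        \sum_(0 <= n1 < n.+1) \sum_(0 <= n2 < (2 * n1).+1)
          q ^+ (n1 ^ 2 + n2 ^ 2 - n1 * n2)
            / (qpoch q q (n - n1) * qpoch q q n1) * qbinom q (2 * n1) n2].
Proof.
move=> q; have q_unit := @qpoch_fpsX_unit int.
have [-> -> -> -> ->] :=
  cyl_system_unique cylF_system (qtrans_inner_system q_unit) n.
split.
- exact: qtrans_inner400.
- exact: qtrans_inner310.
- exact: qtrans_inner301.
- exact: qtrans_inner220.
- exact: qtrans_inner211.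
Qed.
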